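(* Let $X$ be a real Banach space that is uniformly convex and uniformly smooth (hence reflexive), with norm dual $X^*$, and let $J:X\to X^*$ be its normalized duality map, with inverse $J^{-1}:X^*\to X$. Then the polar $K^\circ$ of every nonempty closed convex cone $K\subseteq X$ is convex if and only if, for every two-dimensional linear subspace $D^*\subseteq X^*$, the image $J^{-1}(D^* )$ is a two-dimensional linear subspace of $X$.
   Context: For a nonempty closed convex set $C\subseteq X$ the metric projection $P_C:X\to C$ is $P_Cx=\operatorname{argmin}\{\|x-c\|:c\in C\}$; in a uniformly convex, uniformly smooth Banach space it is well defined, single valued and continuous. A cone is a nonempty set $K$ with $\lambda x\in K$ for all $x\in K$, $\lambda\ge 0$; a convex cone additionally satisfies $x+y\in K$ for all $x,y\in K$. The polar of a closed convex cone $K$ is $K^\circ=\{x\in X: P_Kx=0\}$. The normalized duality map $J:X\to X^*$ is defined by $\langle Jx,x\rangle=\|Jx\|_{X^*}\|x\|=\|x\|^2=\|Jx\|_{X^*}^2$, where $\langle\cdot,\cdot\rangle$ is the duality pairing; in this setting $J$ is a well-defined, positively homogeneous (indeed odd and homogeneous) homeomorphism of $X$ onto $X^*$. *)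

(* Defs.v *)
From HB Require Import structures.
From mathcomp Require Import all_boot all_order all_algebra.
From mathcomp Require Import all_classical all_reals all_analysis.
Set Implicit Arguments. Unset Strict Implicit. Unset Printing Implicit Defensive.
Import Order.TTheory GRing.Theory Num.Theory.
Import numFieldNormedType.Exports.
Local Open Scope classical_set_scope.
Local Open Scope ring_scope.

Section Defs.
Variables (R : realType) (X : completeNormedModType R).

Definition uniformly_convex : Prop :=
  forall eps : R, 0 < eps -> eps <= 2 -> exists2 delta : R, 0 < delta &
    forall x y : X, `|x| <= 1 -> `|y| <= 1 -> eps <= `|x - y| ->
      `|(2^-1) *: (x + y)| <= 1 - delta.

Definition modulus_of_smoothness (t : R) : R :=
  sup [set ((`|x + t *: y| + `|x - t *: y|) / 2 - 1) | x in [set x : X | `|x| = 1]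
        & y in [set y : X | `|y| = 1]].

Definition uniformly_smooth : Prop :=
  (fun t => modulus_of_smoothness t / t) @ at_right (0 : R) --> (0 : R).

Definition dual_elt (f : X -> R) : Prop :=
  (forall (a : R) (x y : X), f (a *: x + y) = a * f x + f y) /\ continuous f.

Definition dual_norm (f : X -> R) : R :=
  sup [set `|f x| | x in [set x : X | `|x| <= 1]].

Definition duality_map (J : X -> (X -> R)) : Prop :=
  forall x : X, dual_elt (J x) /\
    J x x = dual_norm (J x) * `|x| /\
    dual_norm (J x) * `|x| = `|x| ^+ 2 /\
    `|x| ^+ 2 = dual_norm (J x) ^+ 2.

Definition is_cone (K : set X) : Prop :=
  K !=set0 /\ forall (x : X) (l : R), K x -> 0 <= l -> K (l *: x).

Definition is_convex_cone (K : set X) : Prop :=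
  is_cone K /\ forall x y : X, K x -> K y -> K (x + y).

Definition is_metric_proj (C : set X) (x p : X) : Prop :=
  C p /\ forall c : X, C c -> `|x - p| <= `|x - c|.

Definition polar (K : set X) : set X := [set x | is_metric_proj K x 0].

Definition dual_span2 (f g : X -> R) : set (X -> R) :=
  [set h | exists a b : R, h = (fun y => a * f y + b * g y)].

Definition dual_lin_indep2 (f g : X -> R) : Prop :=
  forall a b : R, (fun y => a * f y + b * g y) = (fun _ => 0) -> a = 0 /\ b = 0.

Definition two_dim_dual_subspace (D : set (X -> R)) : Prop :=
  exists f g : X -> R, [/\ dual_elt f, dual_elt g, dual_lin_indep2 f g &
    D = dual_span2 f g].

Definition lin_indep2 (u v : X) : Prop :=
  forall a b : R, a *: u + b *: v = 0 -> a = 0 /\ b = 0.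

Definition two_dim_subspace (S : set X) : Prop :=
  exists u v : X, lin_indep2 u v /\
    S = [set x | exists a b : R, x = a *: u + b *: v].

End Defs.

(* Main.v *)
Require Import Defs.
From HB Require Import structures.
From mathcomp Require Import all_boot all_order all_algebra.
From mathcomp Require Import all_classical all_reals all_analysis.
From mathcomp Require Import ring lra.
Import Order.TTheory GRing.Theory Num.Theory.
Import numFieldNormedType.Exports.
Local Open Scope classical_set_scope.
Local Open Scope ring_scope.

(** Smoothness makes the functional [J x] norming [x] unique and [J]
continuous along segments, and identifies the polar of a cone [K] with
[{x | J x <= 0 on K}]; uniform convexity makes [J] a bijection onto the dual.

If polars are convex and [D] is spanned by [f] and [g], the polar of
[ker f `&` ker g] is [J^-1 D], which is therefore a linear subspace. It
contains [u = J^-1 f] and [v = J^-1 g], and for [h] in it the intermediate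
value theorem on a segment from [u] to [v] or [- v] yields a point whose image
is proportional to [J h], so that [h] lies in the span of [u] and [v].

Conversely, if [J^-1 (span (J x) (J y))] is a subspace, then along the segment
[z_t] from [x] to [y] one has [J z_t = a_t J x + b_t J y]; injectivity keeps
the continuous coefficients from changing sign, so [J z_t <= 0] wherever
[J x <= 0] and [J y <= 0]. *)

(** * Algebra of linear functionals *)

Section ScalarForms.
Set Implicit Arguments.
Unset Strict Implicit.
Context {R : realType} {X : lmodType R}.
Implicit Types (f g : X -> R) (x y : X).

Lemma scalar_form0 f : scalar f -> f 0 = 0.
Proof. by move=> fl; have := fl (-1) 0 0; rewrite scaler0 addr0; lra. Qed.

Lemma scalar_formZ f a x : scalar f -> f (a *: x) = a * f x.
Proof. by move=> fl; have := fl a x 0; rewrite addr0 (scalar_form0 fl) addr0. Qed.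

Lemma scalar_formD f x y : scalar f -> f (x + y) = f x + f y.
Proof. by move=> fl; have := fl 1 x y; rewrite scale1r mul1r. Qed.

Lemma scalar_formN f x : scalar f -> f (- x) = - f x.
Proof. by move=> fl; rewrite -scaleN1r scalar_formZ// mulN1r. Qed.

Lemma scalar_formB f x y : scalar f -> f (x - y) = f x - f y.
Proof. by move=> fl; rewrite scalar_formD// scalar_formN. Qed.

End ScalarForms.

(** * Functionals norming a point: uniqueness, injectivity, existence *)

Section Support.
Set Implicit Arguments.
Unset Strict Implicit.
Context {R : realType} {X : completeNormedModType R}.
Implicit Types (f g : X -> R) (x y : X).

(** Describes the value of the duality map at [x] without the supremum in [dual_norm]; continuity of
    [f] is implied by the bound. *)
Definition supports x f :=
  [/\ scalar f, f x = `|x| ^+ 2 & forall y, f y <= `|x| * `|y|].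

Lemma supports_norm x f y : supports x f -> `|f y| <= `|x| * `|y|.
Proof.
case=> fl _ fb; rewrite ler_norml fb andbT lerNl -scalar_formN//.
by rewrite (le_trans (fb _))// normrN.
Qed.

Lemma supportsZ c x f : supports x f -> supports (c *: x) (fun y => c * f y).
Proof.
move=> xf; case: (xf) => fl fx fb; split.
- by move=> a u v; rewrite fl; ring.
- by rewrite scalar_formZ// fx normrZ exprMn -normrX ger0_norm ?sqr_ge0//; ring.
- move=> y; rewrite (le_trans (ler_norm _))// normrM normrZ -mulrA.
  by rewrite ler_wpM2l// supports_norm.
Qed.

(** Continuity at 0 gives a ball of radius [d] on which [f] stays below 1 in absolute value; any
    nonzero [y] is rescaled to norm [d / 2]. *)
Lemma dual_elt_bounded f : dual_elt f ->
  exists2 M, 0 < M & forall y, `|f y| <= M * `|y|.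
Proof.
move=> [fl fc].
have /cvgrPdist_lt/(_ 1 ltr01) := fc 0.
move=> /nbhs_ballP[d /= d0 fd].
exists (2 / d) => [|y]; first by rewrite divr_gt0.
have [->|y0] := eqVneq y 0; first by rewrite (scalar_form0 fl) !normr0 mulr0.
have ny : 0 < `|y| by rewrite normr_gt0.
have c0 : 0 < d / 2 / `|y| by rewrite !divr_gt0.
have /fd /= : ball 0 d ((d / 2 / `|y|) *: y).
  rewrite -ball_normE /ball_ /= sub0r normrN normrZ gtr0_norm//.
  by rewrite divfK ?gt_eqF//; lra.
rewrite (scalar_form0 fl) sub0r normrN scalar_formZ// normrM gtr0_norm//.
rewrite -ltr_pdivlMl// mulr1 !invf_div => /ltW/le_trans; apply.
by rewrite le_eqVlt; apply/orP; left; apply/eqP; field; rewrite gt_eqF.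
Qed.

(** The defining equations force [dual_norm (J x)] to be the norm of [x]. Boundedness of [J x] is
    established first, so that the supremum really is an upper bound. *)
Lemma duality_map_supports (J : X -> X -> R) x :
  duality_map J -> supports x (J x).
Proof.
move=> /(_ x)[Jd [JE [nE nE2]]]; have [Jl _] := Jd.
have [M M0 JM] := dual_elt_bounded Jd.
have ub : has_ubound [set `|J x y| | y in [set y : X | `|y| <= 1]].
  exists M => _ [y /= y1 <-]; rewrite (le_trans (JM y))//.
  by rewrite ler_piMr// ltW.
have nJ0 : 0 <= dual_norm (J x).
  by apply: (ub_le_sup ub); exists 0; rewrite /= ?normr0// (scalar_form0 Jl) normr0.
have nJ : dual_norm (J x) = `|x|.
  by apply/eqP; rewrite -(@eqrXn2 _ 2)// nE2.
split=> //; first by rewrite JE nE.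
move=> y; rewrite -nJ; have [->|y0] := eqVneq y 0.
  by rewrite (scalar_form0 Jl) normr0 mulr0.
have ny : 0 < `|y| by rewrite normr_gt0.
rewrite -ler_pdivrMr// mulrC -scalar_formZ//.
apply: (le_trans (ler_norm _)); apply: (ub_le_sup ub).
by exists (`|y|^-1 *: y) => //=; rewrite normrZ normfV normr_id mulVf ?gt_eqF.
Qed.

(** One [t] with modulus below [e / 2 * t] serves all unit vectors; the triangle inequality bounds
    the set under the supremum by [t]. *)
Lemma uniformly_smooth_bound : uniformly_smooth X -> forall e : R, 0 < e ->
  exists2 t : R, 0 < t & forall x y, `|x| = 1 -> `|y| = 1 ->
    `|x + t *: y| + `|x - t *: y| <= 2 + e * t.
Proof.
move=> /cvgrPdist_lt us e e0.
have [t [/= t0]] : exists t : R, 0 < t /\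
    `|0 - modulus_of_smoothness X t / t| < e / 2.
  have e20 : 0 < e / 2 by rewrite divr_gt0.
  have /filter_ex[t [t0 ?]] : \forall t \near 0^'+, 0 < t /\
      `|0 - modulus_of_smoothness X t / t| < e / 2.
    by apply: filterI; [exact: nbhs_right_gt|exact: us].
  by exists t.
rewrite sub0r normrN => mt; exists t => // x y x1 y1.
have /(le_lt_trans (ler_norm _)) := mt; rewrite ltr_pdivrMr// => mt'.
suff : (`|x + t *: y| + `|x - t *: y|) / 2 - 1 <= modulus_of_smoothness X t by lra.
apply: ub_le_sup; last by exists x => //; exists y.
exists t => _ [u /= u1 [v /= v1 <-]].
have := ler_normD u (t *: v); have := ler_normB u (t *: v).
rewrite normrZ u1 v1 (gtr0_norm t0); lra.
Qed.

(* Adding the support inequalities at [x + t y] and [x' - t y] to the bound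
   supplied by the modulus of smoothness isolates [t (f y - f' y)]. *)
Lemma supports_unif_continuous : uniformly_smooth X -> forall e : R, 0 < e ->
  exists2 d : R, 0 < d & forall x x' f f', `|x| = 1 -> `|x'| = 1 ->
    supports x f -> supports x' f' -> `|x - x'| <= d ->
    forall y, `|f y - f' y| <= e * `|y|.
Proof.
move=> us e e0; have e20 : 0 < e / 2 by rewrite divr_gt0.
have [t t0 ht] := uniformly_smooth_bound us e20.
(* Half of the error [e * t] goes to smoothness, the other half to the distance from [x] to [x']. *)
exists (e / 2 * t); first by rewrite mulr_gt0.
suff unit_bound x x' f f' y : `|x| = 1 -> `|x'| = 1 -> supports x f ->
    supports x' f' -> `|x - x'| <= e / 2 * t -> `|y| = 1 -> f y - f' y <= e.
  move=> x x' f f' x1 x'1 xf xf' xx' y.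
  have [fl _ _] := xf; have [fl' _ _] := xf'.
  have [->|y0] := eqVneq y 0.
    by rewrite (scalar_form0 fl) (scalar_form0 fl') subrr !normr0 mulr0.
  have ny : 0 < `|y| by rewrite normr_gt0.
  have u1 : `| `|y|^-1 *: y| = 1 by rewrite normrZ normfV normr_id mulVf ?gt_eqF.
  have E1 := unit_bound x x' f f' _ x1 x'1 xf xf' xx' u1.
  have E2 := unit_bound x' x f' f _ x'1 x1 xf' xf.
  rewrite distrC in E2; have {E2} := E2 _ xx' u1.
  move: E1; rewrite !(scalar_formZ _ _ fl) !(scalar_formZ _ _ fl') -!mulrBr !ler_pdivrMl// => E1 E2.
  by rewrite ler_norml; apply/andP; split; lra.
move=> x1 x'1 [fl fx fb] [fl' fx' fb'] xx' y1.
have := fb (x + t *: y); have := fb' (x' - t *: y).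
rewrite (scalar_formD _ _ fl) (scalar_formB _ _ fl').
rewrite (scalar_formZ _ _ fl) (scalar_formZ _ _ fl') fx fx' x1 x'1 expr1n !mul1r.
have := ht x y x1 y1.
have : `|x' - t *: y| <= `|x - x'| + `|x - t *: y|.
  rewrite (distrC x x') (le_trans _ (ler_normD _ _))//.
  by rewrite addrA subrK.
move=> *; suff : t * (f y - f' y) <= t * e by rewrite ler_pM2l.
lra.
Qed.

(** After normalizing [x], the uniform continuity estimate is applied with both points equal, for
    every [e]. *)
Lemma supports_unique x f g :
  uniformly_smooth X -> supports x f -> supports x g -> f = g.
Proof.
move=> us xf xg; apply/funext => y.
have [x0|x0] := eqVneq x 0.
  have := supports_norm y xf; have := supports_norm y xg.
  by rewrite x0 normr0 !mul0r !normr_le0 => /eqP-> /eqP->.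
have nx : 0 < `|x| by rewrite normr_gt0.
have u1 : `| `|x|^-1 *: x| = 1 by rewrite normrZ normfV normr_id mulVf ?gt_eqF.
have uf := supportsZ `|x|^-1 xf; have ug := supportsZ `|x|^-1 xg.
suff : `| `|x|^-1 * f y - `|x|^-1 * g y| <= 0.
  rewrite normr_le0 -mulrBr mulf_eq0 invr_eq0 gt_eqF//= subr_eq0.
  by move=> /eqP.
apply/ler_addgt0Pl => e e0; rewrite addr0.
have y1 : 0 < `|y| + 1 by rewrite ltr_wpDl.
have [d d0 cd] := supports_unif_continuous us (divr_gt0 e0 y1).
have := cd _ _ _ _ u1 u1 uf ug; rewrite subrr normr0 => /(_ (ltW d0) y).
move=> /le_trans; apply; rewrite mulrAC ler_pdivrMr// ler_pM2l//; lra.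
Qed.

(** Both points have norm equal to that of [f]. If they differed, the midpoint of their
    normalizations would have norm below 1 by uniform convexity, although [f] still attains its norm
    there. *)
Lemma supports_inj x y f :
  uniformly_convex X -> supports x f -> supports y f -> x = y.
Proof.
move=> uc [fl fx fxb] [_ fy fyb].
have le_norm (u v : X) : f v = `|v| ^+ 2 -> (forall y, f y <= `|u| * `|y|) ->
    `|v| <= `|u|.
  move=> fv fub; have [->|v0] := eqVneq v 0; first by rewrite normr0.
  by have := fub v; rewrite fv expr2 ler_pM2r// normr_gt0.
have nxy : `|x| = `|y|.
  by apply/eqP; rewrite eq_le (le_norm y x)// (le_norm x y).
have [x0|x0] := eqVneq x 0.
  by apply/esym/eqP; rewrite x0 -normr_eq0 -nxy x0 normr0.
apply/eqP; apply: contraT => xy.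
have nx : 0 < `|x| by rewrite normr_gt0.
have nxV : 0 < `|x|^-1 by rewrite invr_gt0.
have unit (u : X) : `|u| = `|x| -> `| `|x|^-1 *: u| = 1.
  by rewrite normrZ (gtr0_norm nxV) => ->; rewrite mulVf ?gt_eqF.
have e0 : 0 < `| `|x|^-1 *: x - `|x|^-1 *: y|.
  by rewrite normr_gt0 -scalerBr scaler_eq0 gt_eqF//= subr_eq0.
have e2 : `| `|x|^-1 *: x - `|x|^-1 *: y| <= 2.
  by rewrite (le_trans (ler_normB _ _))// !unit//; lra.
have [d d0 /(_ (`|x|^-1 *: x) (`|x|^-1 *: y))] := uc _ e0 e2.
rewrite !unit// => /(_ (lexx _) (lexx _) (lexx _)) mid.
have := fxb (2^-1 *: (`|x|^-1 *: x + `|x|^-1 *: y)).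
rewrite (scalar_formZ _ _ fl) (scalar_formD _ _ fl) !(scalar_formZ _ _ fl).
have -> : 2^-1 * (`|x|^-1 * f x + `|x|^-1 * f y) = `|x|.
  by rewrite fx fy -nxy; field; rewrite gt_eqF.
by rewrite -[X in X <= _]mulr1 ler_pM2l//; lra.
Qed.

(* The slices [{y in the unit ball | m - d < f y}] have diameter tending to 0
   by uniform convexity; their common limit is where [f] attains its norm. *)
Lemma supports_surj f :
  uniformly_convex X -> dual_elt f -> exists x, supports x f.
Proof.
move=> uc fd; have [fl fc] := fd; have [M M0 fM] := dual_elt_bounded fd.
have [f0|/existsNP[y0 fy0]] := pselect (forall y, f y = 0).
  exists 0; split=> // [|y]; first by rewrite f0 normr0 expr0n.
  by rewrite f0 normr0 mul0r.
pose B := [set f y | y in [set y : X | `|y| <= 1]].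
have ubB : has_ubound B.
  exists M => _ [y /= y1 <-]; rewrite (le_trans (ler_norm _))//.
  by rewrite (le_trans (fM _))// ler_piMr// ltW.
have supB : has_sup B by split=> //; exists (f 0), 0; rewrite //= normr0.
pose m := sup B.
have fm y : f y <= m * `|y|.
  have [->|y0'] := eqVneq y 0; first by rewrite (scalar_form0 fl) normr0 mulr0.
  have ny : 0 < `|y| by rewrite normr_gt0.
  rewrite -ler_pdivrMr// mulrC -(scalar_formZ _ _ fl); apply: (ub_le_sup ubB).
  by exists (`|y|^-1 *: y) => //=; rewrite normrZ normfV normr_id mulVf ?gt_eqF.
have m0 : 0 < m.
  have ny0 : 0 < `|y0|.
    by rewrite normr_gt0; apply: contra_notN fy0 => /eqP->; exact: scalar_form0.
  have := fm y0; have := fm (- y0); rewrite (scalar_formN _ fl) normrN => fN fP.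
  rewrite -(pmulr_lgt0 _ ny0); case: (ltgtP 0 (f y0)) => [fpos|fneg|fz].
  - exact: lt_le_trans fP.
  - by rewrite (lt_le_trans _ fN)// oppr_gt0.
  - by case: fy0.
pose S (d : R) := [set y : X | `|y| <= 1 /\ m - d < f y].
have Sn0 d : 0 < d -> S d !=set0.
  by move=> /sup_adherent/(_ supB)[_ [y /= y1 <-] my]; exists y.
pose F := filter_from [set d : R | 0 < d] S.
have FF : ProperFilter F.
  apply: filter_from_proper => [|d /=]; last exact: Sn0.
  apply: filter_from_filter => [|d d' /= d0 d'0]; first by exists 1 => /=.
  exists (Num.min d d') => /=; first by rewrite lt_min d0 d'0.
  move=> y [y1]; rewrite ltrBlDr -ltrBlDl lt_min => /andP[fd1 fd2].
  by split; split=> //; lra.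
have /cauchy_cvgP Fc : cauchy F.
  apply: cauchy_exP => e e0.
  (* Uniform convexity is stated only for separations up to 2. Two points of the slice [S (m * d)]
     at least [Num.min e 2] apart would have a midpoint of norm at most [1 - d], where [f]
     nevertheless exceeds [m * (1 - d)]. *)
  have e'0 : 0 < Num.min e 2 by rewrite lt_min e0 ltr0n.
  have e'2 : Num.min e 2 <= 2 by rewrite ge_min lexx orbT.
  have [d d0 ucd] := uc _ e'0 e'2.
  have md0 : 0 < m * d by rewrite mulr_gt0.
  have [y [y1 fy]] := Sn0 _ md0.
  exists y; exists (m * d) => //= z [z1 fz].
  rewrite -ball_normE /ball_ /=; apply: (@lt_le_trans _ _ (Num.min e 2)).
    rewrite ltNge; apply/negP => /(ucd _ _ y1 z1) yz.
    have := fm (2^-1 *: (y + z)).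
    rewrite (scalar_formZ _ _ fl) (scalar_formD _ _ fl) => fyz.
    have : m * `|2^-1 *: (y + z)| <= m * (1 - d) by rewrite ler_pM2l.
    by move: fy fz fyz; lra.
  by rewrite ge_min lexx.
pose l := lim F.
have l1 : `|l| <= 1.
  apply: (@closed_cvg _ _ F FF id [set z : X | `|z| <= 1]) => //.
    by apply: preimage_closed (@closed_le R 1) => z _; exact: norm_continuous.
  by exists 1 => //= z [].
have fl_ge : m <= f l.
  apply/ler_addgt0Pr => e e0; rewrite -lerBlDr.
  apply: (@closed_cvg _ _ F FF id [set z : X | m - e <= f z]) => //.
    by apply: preimage_closed (@closed_ge R (m - e)) => z _; exact: fc.
  by exists e => //= z [_ /ltW].
have nl : `|l| = 1.
  apply/eqP; rewrite eq_le l1 -(ler_pM2l m0) mulr1.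
  exact: le_trans (fm l).
have flm : f l = m by apply/eqP; rewrite eq_le fl_ge andbT -[m]mulr1 -nl.
(* [l] is a unit vector with [f l = m]; scaling by [m] gives the point the norm of [f]. *)
by exists (m *: l); split=> // [|y];
  rewrite ?(scalar_formZ _ _ fl) normrZ nl mulr1 gtr0_norm// flm.
Qed.

End Support.

(** * Pairs of independent functionals and their common kernel *)

Section IndependentForms.
Set Implicit Arguments.
Unset Strict Implicit.
Context {R : realType} {X : completeNormedModType R}.
Implicit Types (f g h : X -> R).

Lemma dual_lin_indep2C f g : dual_lin_indep2 f g -> dual_lin_indep2 g f.
Proof.
move=> fg a b ab; suff [-> ->] : b = 0 /\ a = 0 by [].
by apply: fg; rewrite -ab; apply/funext => y; rewrite addrC.
Qed.

(** Otherwise [f] vanishes on the kernel of [g], which makes the two functionals proportional. *)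
Lemma dual_lin_indep2_sep f g : scalar f -> scalar g -> dual_lin_indep2 f g ->
  exists w, f w = 1 /\ g w = 0.
Proof.
move=> fl gl fg.
have [w gw fw] : exists2 w, g w = 0 & f w != 0.
  apply: contrapT => nw.
  have gf w : g w = 0 -> f w = 0.
    by move=> gw; apply/eqP; apply: contraT => fw; case: nw; exists w.
  have [g0|/existsNP[u /eqP gu]] := pselect (forall y, g y = 0).
    have [] := fg 1 1; last by move=> /eqP; rewrite oner_eq0.
    by apply/funext => y; rewrite g0 gf// !mulr0 addr0.
  have [] := fg (g u) (- f u); last by move=> /eqP; rewrite (negbTE gu).
  apply/funext => y; have : f (g u *: y - g y *: u) = 0.
    apply: gf; rewrite (scalar_formB _ _ gl) !(scalar_formZ _ _ gl); ring.
  by rewrite (scalar_formB _ _ fl) !(scalar_formZ _ _ fl) => <-; ring.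
exists ((f w)^-1 *: w).
by rewrite (scalar_formZ _ _ fl) (scalar_formZ _ _ gl) gw mulr0 mulVf.
Qed.

(** With [p], [q] dual to [f], [g], the vector [y - f y *: p - g y *: q] lies in the common kernel,
    so [h] is determined by [h p] and [h q]. *)
Lemma kernel_span f g h : scalar f -> scalar g -> scalar h ->
  dual_lin_indep2 f g -> (forall y, f y = 0 -> g y = 0 -> h y = 0) ->
  exists a b, h = (fun y => a * f y + b * g y).
Proof.
move=> fl gl hl fg fgh.
have [p [fp gp]] := dual_lin_indep2_sep fl gl fg.
have [q [gq fq]] := dual_lin_indep2_sep gl fl (dual_lin_indep2C fg).
exists (h p), (h q); apply/funext => y.
have : h (y - f y *: p - g y *: q) = 0.
  apply: fgh.
    by rewrite !(scalar_formB _ _ fl) !(scalar_formZ _ _ fl) fp fq; ring.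
  by rewrite !(scalar_formB _ _ gl) !(scalar_formZ _ _ gl) gp gq; ring.
by rewrite !(scalar_formB _ _ hl) !(scalar_formZ _ _ hl); lra.
Qed.

End IndependentForms.

(** Replaces the bundled interval weight by a real number with explicit bounds. *)
Lemma convex_setP {R : realType} {X : lmodType R} (A : set X) :
  convex_set A <-> forall (x y : X) (t : R), 0 <= t <= 1 -> A x -> A y ->
    A ((1 - t) *: x + t *: y).
Proof.
split=> [Aconv x y t /andP[t0 t1] /mem_set Ax /mem_set Ay|Aconv x y t].
  by have := Aconv y x (Itv01 t0 t1) Ay Ax; rewrite inE addrC.
rewrite !inE => Ax Ay.
rewrite /conv /=.
have := Aconv y x t%:num; rewrite addrC; apply=> //.
by apply/andP; split.
Qed.

(** * Homogeneity and continuity of the duality map; description of polars *)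

Section DualityMap.
Set Implicit Arguments.
Unset Strict Implicit.
Context {R : realType} {X : completeNormedModType R} (J : X -> X -> R).
Hypotheses (us : uniformly_smooth X) (dualJ : duality_map J).

Let Jd x : dual_elt (J x). Proof. by have [] := dualJ x. Qed.

Let supJ x : supports x (J x). Proof. exact: duality_map_supports. Qed.

Let Jl x : scalar (J x). Proof. by have [] := supJ x. Qed.

Lemma duality_map_scale c x : J (c *: x) = (fun y => c * J x y).
Proof. exact: supports_unique us (supJ _) (supportsZ c (supJ x)). Qed.

Lemma duality_map0 : J 0 = (fun _ => 0).
Proof.
by rewrite -(scale0r (0 : X)) duality_map_scale; apply/funext => y; rewrite mul0r.
Qed.

Lemma duality_map_eq0 x : J x = (fun _ => 0) -> x = 0.
Proof.
have [_ + _] := supJ x => /[swap] -> /esym/eqP.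
by rewrite sqrf_eq0 normr_eq0 => /eqP.
Qed.

(** At 0 the norm bound suffices. Elsewhere homogeneity reduces the claim to the unit sphere, where
    the uniform estimate applies. *)
Lemma duality_map_continuous w : continuous (fun x => J x w).
Proof.
move=> x; have [->|x0] := eqVneq x 0.
  apply/cvgrPdist_le => e e0 /=.
  have w1 : 0 < `|w| + 1 by rewrite ltr_wpDl.
  near=> z; rewrite duality_map0 sub0r normrN (le_trans (supports_norm w (supJ z)))//.
  have : `|z| <= e / (`|w| + 1).
    by near: z; apply: nbhs0_le; rewrite divr_gt0.
  rewrite ler_pdivlMr// mulrDr mulr1 => /(le_trans _); apply.
  by rewrite lerDl.
have -> : (fun z => J z w) = (fun z => `|z| * J (`|z|^-1 *: z) w).
  apply/funext => z; rewrite duality_map_scale.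
  have [->|z0] := eqVneq z 0; first by rewrite duality_map0 !mulr0.
  by rewrite mulrA divff ?mul1r// normr_eq0.
apply: cvgM; first exact: norm_continuous.
have n1 (z : X) : z != 0 -> `| `|z|^-1 *: z| = 1.
  by move=> z0; rewrite normrZ normfV normr_id mulVf ?normr_eq0.
apply/cvgrPdist_le => e e0 /=.
have w1 : 0 < `|w| + 1 by rewrite ltr_wpDl.
have [d d0 cd] := supports_unif_continuous us (divr_gt0 e0 w1).
have normalize_cvg : `|z|^-1 *: z @[z --> x] --> `|x|^-1 *: x.
  apply: cvgZ; last exact: cvg_id.
  by apply: cvgV; rewrite ?normr_eq0//; exact: norm_continuous.
near=> z.
have z0 : z != 0.
  near: z; apply: (@open_nbhs_nbhs _ x [set z | z != 0]); split=> //.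
  have -> : [set z : X | z != 0] = ~` [set 0].
    by apply/seteqP; split=> z /= /eqP.
  apply/closed_openC/accessible_closed_set1/hausdorff_accessible.
    exact: norm_hausdorff.
have xz : `| `|x|^-1 *: x - `|z|^-1 *: z| <= d.
  by near: z; move/cvgrPdist_le : normalize_cvg; apply.
rewrite (le_trans (cd _ _ _ _ (n1 x x0) (n1 z z0) (supJ _) (supJ _) xz w))//.
by rewrite mulrAC ler_pdivrMr// ler_pM2l//; lra.
Unshelve. all: by end_near. Qed.

Lemma duality_map_segment_continuous x y w :
  continuous (fun t : R => J ((1 - t) *: x + t *: y) w).
Proof.
move=> t; apply: (@continuous_comp _ _ _ (fun t : R => (1 - t) *: x + t *: y)
  (fun x => J x w)); last exact: duality_map_continuous.
apply: cvgD; apply: cvgZ; try exact: cvg_cst; last exact: cvg_id.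
by apply: cvgB; [exact: cvg_cst|exact: cvg_id].
Qed.

Lemma polarE K : is_cone K -> polar K = [set x | forall c, K c -> J x c <= 0].
Proof.
move=> [[c0 Kc0] Kc]; apply/seteqP; split=> x /=; last first.
  move=> Jx; split; first by rewrite -(scale0r c0); exact: Kc.
  move=> c /Jx Jxc; rewrite subr0; have [x0|x0] := eqVneq x 0.
    by rewrite x0 normr0.
  have [_ JE Jb] := supJ x.
  (* If [J x c <= 0], the squared norm of [x] is at most [J x (x - c)]; dividing by the norm of [x]
     gives minimality of 0. *)
  have := Jb (x - c); rewrite (scalar_formB _ _ (Jl x)) JE => xc.
  by rewrite -(@ler_pM2l _ `|x|) ?normr_gt0// -expr2; lra.
(* If [J x c > 0], continuity keeps [J (x - t *: c) c] positive for some small [t > 0]. Evaluating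
   [J (x - t *: c)] at [x - t *: c] then shows that [t *: c] is strictly closer to [x] than 0. *)
move=> [_ proj] c Kc'; rewrite leNgt; apply/negP => Jc.
have /cvgrPdist_lt/(_ _ Jc) : J (x - t *: c) c @[t --> 0^'+] --> J x c.
  apply: cvg_at_right_filter.
  have -> : J x c = J (x - 0 *: c) c by rewrite scale0r subr0.
  apply: (@continuous_comp _ _ _ (fun t : R => x - t *: c) (fun x => J x c));
    last exact: duality_map_continuous.
  by apply: cvgB; [exact: cvg_cst|apply: cvgZ; [exact: cvg_id|exact: cvg_cst]].
move=> near_pos.
have /filter_ex[t [t0 Jt]] : \forall t \near (0 : R)^'+, 0 < t /\
    `|J x c - J (x - t *: c) c| < J x c.
  by apply: filterI; [exact: nbhs_right_gt|exact: near_pos].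
have Jtc : 0 < J (x - t *: c) c by move: Jt; rewrite ltr_norml; lra.
have [_ JE Jb] := supJ (x - t *: c).
have := JE; rewrite [in LHS](scalar_formB _ _ (Jl _)) (scalar_formZ _ _ (Jl _)).
have := Jb x; have := proj (t *: c) (Kc _ _ Kc' (ltW t0)); rewrite subr0 => pr Jx E.
have : `|x - t *: c| * `|x| <= `|x - t *: c| ^+ 2 by rewrite expr2 ler_wpM2l.
by have := mulr_gt0 t0 Jtc; lra.
Qed.

Lemma duality_map_segment_zero x y w : J x w * J y w <= 0 ->
  exists2 s : R, 0 <= s <= 1 & J ((1 - s) *: x + s *: y) w = 0.
Proof.
move=> xy; have c := @duality_map_segment_continuous x y w.
have [|s] := IVT (v := 0) ler01 (continuous_subspaceT c); last first.
  by rewrite in_itv /=; exists s.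
rewrite subr0 scale1r scale0r addr0 subrr scale0r add0r scale1r.
apply/andP; split; rewrite leNgt (lt_min, gt_max); apply/negP => /andP[x0 y0].
  by have := mulr_gt0 x0 y0; rewrite ltNge xy.
by move: xy; rewrite leNgt nmulr_rgt0// y0.
Qed.

(** * Bijectivity of the duality map and transfer of linear dependence *)

Hypothesis uc : uniformly_convex X.

Lemma duality_map_inj : injective J.
Proof. by move=> x y xy; apply: (supports_inj uc (supJ x)); rewrite xy. Qed.

Lemma duality_map_surj f : dual_elt f -> exists x, J x = f.
Proof.
move=> /(supports_surj uc)[x xf]; exists x.
exact: supports_unique us (supJ x) xf.
Qed.

(** By homogeneity the relation reads [J (a *: x) = J (- b *: y)], and [J] is injective. *)
Lemma duality_map_dependent x y a b :
  (fun w => a * J x w + b * J y w) = (fun _ => 0) -> a *: x + b *: y = 0.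
Proof.
move=> ab; apply/eqP; rewrite addr_eq0 -scaleNr; apply/eqP/duality_map_inj.
rewrite !duality_map_scale; apply/funext => w.
by have := congr1 (@^~ w) ab; rewrite /= => /eqP; rewrite addr_eq0 mulNr => /eqP.
Qed.

Lemma duality_map_lin_indep2 x y : dual_lin_indep2 (J x) (J y) -> lin_indep2 x y.
Proof.
move=> xy a b ab; apply: xy; apply/funext => w.
have : J (a *: x) w = J (- b *: y) w.
  by congr (J _ w); apply/eqP; rewrite scaleNr -addr_eq0 ab.
by rewrite !duality_map_scale => ->; ring.
Qed.

(* If the first coordinate of [J z_t] were negative it would vanish at some
   earlier [z_s]; by injectivity [z_s] would then be a multiple of [y]. *)
Lemma segment_coef_ge0 x y t a b : dual_lin_indep2 (J x) (J y) -> 0 <= t <= 1 ->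
  (forall s, exists a b, J ((1 - s) *: x + s *: y) =
     (fun w => a * J x w + b * J y w)) ->
  J ((1 - t) *: x + t *: y) = (fun w => a * J x w + b * J y w) -> 0 <= a.
Proof.
move=> xy /andP[t0 t1] span Jt; rewrite leNgt; apply/negP => a0.
(* Evaluation at [w] reads off the coefficient of [J x]. *)
have [w [xw yw]] := dual_lin_indep2_sep (Jl x) (Jl y) xy.
have c := @duality_map_segment_continuous x y w.
have [|s] := IVT (v := 0) t0 (continuous_subspaceT c).
  rewrite subr0 scale1r scale0r addr0 xw Jt xw yw mulr1 mulr0 addr0.
  by rewrite ge_min le_max (ltW a0) ler01 orbT.
rewrite in_itv /= => /andP[s0 st] Js0.
have [a' [b' Js]] := span s.
have a'0 : a' = 0 by move: Js0; rewrite Js xw yw; lra.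
have sy : (1 - s) *: x + s *: y = b' *: y.
  apply: duality_map_inj; rewrite Js duality_map_scale a'0.
  by apply/funext => z; rewrite mul0r add0r.
(* Independence forces [s = 1], hence [t = 1]: the point is [y] itself, whose first coefficient is
   0, not negative. *)
have [] := duality_map_lin_indep2 xy (a := 1 - s) (b := s - b').
  by rewrite (scalerBl s) addrA sy subrr.
move=> s1 _; have t1' : t = 1 by lra.
have := congr1 (@^~ w) Jt; rewrite /= t1' subrr scale0r add0r scale1r xw yw.
lra.
Qed.

(** * From linear preimages of planes to convex polars *)

Lemma polar_convex (K : set X) :
  (forall D : set (X -> R), two_dim_dual_subspace D -> two_dim_subspace (J @^-1` D)) ->
  is_cone K -> convex_set (polar K).
Proof.
move=> subspaces Kcone; apply/convex_setP => x y t t01; rewrite polarE//= => xK yK c Kc.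
have [t0 t1] := andP t01.
have [Jxc Jyc] := (xK c Kc, yK c Kc).
have comb_le0 (a b p q : R) : 0 <= a -> 0 <= b -> p <= 0 -> q <= 0 ->
    a * p + b * q <= 0.
  by move=> a0 b0 p0 q0; rewrite -oppr_ge0 opprD -!mulrN addr_ge0 ?mulr_ge0 ?oppr_ge0.
have [xy|] := pselect (dual_lin_indep2 (J x) (J y)); last first.
  (* Here [x] and [y] are themselves dependent, so the segment lies on a line through 0, where [J]
     is linear. *)
  move=> /existsNP[a /existsNP[b /not_implyP[ab0 ab]]].
  have {}ab0 := duality_map_dependent ab0.
  have [a0|a0] := eqVneq a 0.
    have b0 : b != 0 by apply/eqP => b0; apply: ab; split.
    have y0 : y = 0.
      move: ab0; rewrite a0 scale0r add0r => /eqP; rewrite scaler_eq0 (negbTE b0).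
      by move=> /eqP.
    by rewrite y0 scaler0 addr0 duality_map_scale mulr_ge0_le0//; lra.
  have xy : x = (- (b / a)) *: y.
    apply: (@scalerI _ _ a a0); rewrite scalerA mulrN mulrCA mulfV// mulr1 scaleNr.
    by apply/eqP; rewrite -addr_eq0 ab0.
  move: Jxc; rewrite xy scalerA -scalerDl !duality_map_scale => Jxc.
  by rewrite mulrDl -mulrA comb_le0//; lra.
have [u [v [_ Suv]]] : two_dim_subspace (J @^-1` dual_span2 (J x) (J y)).
  apply: subspaces; exists (J x), (J y); split=> //; exact: Jd.
have span s : exists a b, J ((1 - s) *: x + s *: y) =
    (fun w => a * J x w + b * J y w).
  have Sx : (J @^-1` dual_span2 (J x) (J y)) x.
    by exists 1, 0; apply/funext => w; ring.
  have Sy : (J @^-1` dual_span2 (J x) (J y)) y.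
    by exists 0, 1; apply/funext => w; ring.
  suff : (J @^-1` dual_span2 (J x) (J y)) ((1 - s) *: x + s *: y) by [].
  move: Sx Sy; rewrite Suv => -[a [b ->]] [a' [b' ->]].
  exists ((1 - s) * a + s * a'), ((1 - s) * b + s * b').
  by rewrite !scalerDr !scalerA !scalerDl addrACA.
have [a [b Jz]] := span t.
have a0 := segment_coef_ge0 xy t01 span Jz.
(* The second coefficient is the first one along the reversed segment, at parameter [1 - t]. *)
have b0 : 0 <= b.
  have swap s : (1 - (1 - s)) *: y + (1 - s) *: x = (1 - s) *: x + s *: y.
    by rewrite subKr addrC.
  apply: (@segment_coef_ge0 y x (1 - t) b a (dual_lin_indep2C xy)).
  - by apply/andP; split; lra.
  - move=> s; have [a' [b' Js]] := span (1 - s); exists b', a'.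
    move: Js; rewrite subKr addrC => ->; apply/funext => w; exact: addrC.
  - by rewrite swap Jz; apply/funext => w; exact: addrC.
by rewrite Jz comb_le0.
Qed.

(** * From convex polars to linear preimages of planes *)

Lemma preimage_two_dim (D : set (X -> R)) :
  (forall K : set X, is_convex_cone K -> closed K -> convex_set (polar K)) ->
  two_dim_dual_subspace D -> two_dim_subspace (J @^-1` D).
Proof.
move=> convex_polar [f [g [fd gd fg ->]]].
have [[fl fc] [gl gc]] := (fd, gd).
have [u Ju] := duality_map_surj fd; have [v Jv] := duality_map_surj gd.
have uv : lin_indep2 u v by apply: duality_map_lin_indep2; rewrite Ju Jv.
pose K := [set c | f c = 0] `&` [set c | g c = 0].
have Kcone : is_convex_cone K.
  split; first split.
  - by exists 0; split => /=; exact: scalar_form0.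
  - move=> x l [/= fx gx] _; split => /=.
      by rewrite (scalar_formZ _ _ fl) fx mulr0.
    by rewrite (scalar_formZ _ _ gl) gx mulr0.
  - move=> x y [/= fx gx] [/= fy gy]; split => /=.
      by rewrite (scalar_formD _ _ fl) fx fy addr0.
    by rewrite (scalar_formD _ _ gl) gx gy addr0.
have Kclosed : closed K.
  by apply: closedI; apply: (preimage_closed _ (@closed_eq R 0)) => z _;
    [exact: fc|exact: gc].
have polarK : polar K = J @^-1` dual_span2 f g.
  rewrite polarE; last by have [] := Kcone.
  apply/seteqP; split=> x /=; last first.
    by move=> [a [b ->]] c [/= -> ->]; rewrite !mulr0 addr0.
  (* [K] contains [- c] along with [c], so [J x <= 0] on [K] means that [J x] vanishes there. *)
  move=> xK; apply: kernel_span => // c fc0 gc0; apply/eqP; rewrite eq_le.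
  rewrite xK//= -oppr_le0 -(scalar_formN _ (Jl x)); apply: xK.
  by split => /=; [rewrite (scalar_formN _ fl) fc0|rewrite (scalar_formN _ gl) gc0];
    rewrite oppr0.
have := convex_polar K Kcone Kclosed; rewrite polarK => /convex_setP Sconvex.
pose S := J @^-1` dual_span2 f g.
have Sscale a x : S x -> S (a *: x).
  move=> [b [c Jx]]; exists (a * b), (a * c); rewrite duality_map_scale Jx.
  by apply/funext => w; ring.
have Su : S u by exists 1, 0; rewrite Ju; apply/funext => w; ring.
have Sv : S v by exists 0, 1; rewrite Jv; apply/funext => w; ring.
(* The combination is the midpoint of [(2 * a) *: u] and [(2 * b) *: v]. *)
have Sspan a b : S (a *: u + b *: v).
  have half : 0 <= (2^-1 : R) <= 1 by apply/andP; split; lra.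
  have := Sconvex _ _ _ half (Sscale (2 * a) _ Su) (Sscale (2 * b) _ Sv).
  by rewrite !scalerA; congr (S (_ *: _ + _ *: _)); field.
exists u, v; split => //; apply/seteqP; split=> [h /= [a [b Jh]]|]; last first.
  by move=> _ [a [b ->]]; exact: Sspan.
have [->|h0] := eqVneq h 0; first by exists 0, 0; rewrite !scale0r addr0.
have [p [fp gp]] := dual_lin_indep2_sep fl gl fg.
have [p' [gp' fp']] := dual_lin_indep2_sep gl fl (dual_lin_indep2C fg).
(* The sign makes [J u q = b] and [J (e *: v) q = - (e * a)] have product at most 0. *)
pose e : R := if 0 <= a * b then 1 else -1.
have e0 : e != 0 by rewrite /e; case: ifP; rewrite ?oppr_eq0 oner_eq0.
(* A combination [al * f + be * g] vanishes at [q] exactly when [al * b = be * a], that is, when its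
   coefficients are proportional to those of [J h]. *)
pose q := b *: p - a *: p'.
have fq : f q = b.
  by rewrite (scalar_formB _ _ fl) !(scalar_formZ _ _ fl) fp fp'; ring.
have gq : g q = - a.
  by rewrite (scalar_formB _ _ gl) !(scalar_formZ _ _ gl) gp gp'; ring.
have [|s _] := @duality_map_segment_zero u (e *: v) q.
  by rewrite duality_map_scale Ju Jv fq gq /e; case: ifPn; rewrite -?ltNge; lra.
rewrite scalerA; set z := _ + _ => Jzq.
have z0 : z != 0.
  apply/eqP => /uv[s1 /eqP]; rewrite mulf_eq0 (negbTE e0) orbF => /eqP s0.
  by move: s1; rewrite s0 subr0 => /eqP; rewrite oner_eq0.
have := Sspan (1 - s) (s * e); rewrite -/z => -[al [be Jz]].
move: Jzq; rewrite Jz fq gq => albe.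
have n0 : al ^+ 2 + be ^+ 2 != 0.
  rewrite paddr_eq0 ?sqr_ge0// !sqrf_eq0; apply: contra_neqN z0.
  move=> /andP[/eqP al0 /eqP be0].
  by apply: duality_map_eq0; rewrite Jz al0 be0; apply/funext => w; ring.
(* The projection coefficient of [(a, b)] onto [(al, be)]; as the pairs are parallel, [c] carries
   the second to the first, so [J (c *: z) = J h]. *)
pose c := (a * al + b * be) / (al ^+ 2 + be ^+ 2).
have cal : c * al = a.
  rewrite /c mulrAC; apply: (canLR (mulfK n0)).
  have : be * (al * b + be * - a) = 0 by rewrite albe mulr0.
  lra.
have cbe : c * be = b.
  rewrite /c mulrAC; apply: (canLR (mulfK n0)).
  have : al * (al * b + be * - a) = 0 by rewrite albe mulr0.
  lra.
exists (c * (1 - s)), (c * (s * e)).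
rewrite -!(scalerA c) -scalerDr -/z; apply: duality_map_inj.
rewrite duality_map_scale Jh Jz; apply/funext => w.
by rewrite -cal -cbe; ring.
Qed.

End DualityMap.

Theorem theorem1 (R : realType) (X : completeNormedModType R)
  (J : X -> (X -> R)) :
  uniformly_convex X -> uniformly_smooth X -> duality_map J ->
  ((forall K : set X, is_convex_cone K -> closed K -> convex_set (polar K)) <->
   (forall D : set (X -> R), two_dim_dual_subspace D ->
      two_dim_subspace (J @^-1` D))).
Proof.
move=> uc us dualJ; split=> [polars D D2|subspaces K [Kcone _] _].
  exact: preimage_two_dim.
exact: polar_convex.
Qed.
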